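(* Let $t\ge 1$ be an integer. Then $\chi_p(P_{3t}\Diamond_3 C_3)\le 3$ if $t=1$, $\chi_p(P_{3t}\Diamond_3 C_3)\le 4$ if $2\le t\le 3$, and $\chi_p(P_{3t}\Diamond_3 C_3)\le 5$ if $t\ge 4$. Moreover, equality holds for $t\in\{1,2,3\}$.
   Context: A packing $k$-coloring of a graph $H$ is a map $c:V(H)\to\{1,\ldots,k\}$ such that any two distinct vertices $u,v$ with $c(u)=c(v)=i$ satisfy $d_H(u,v)\ge i+1$. The packing chromatic number $\chi_p(H)$ is the least such $k$. $P_m$ denotes the path $v_1\cdots v_m$ and $C_n$ the cycle on $n$ vertices. Path-aligned product: for positive integers $\ell\mid m$ and a connected vertex-transitive graph $G$ containing $P_\ell$ as a subgraph, $P_m\Diamond_\ell G$ is formed from the path $P_m=v_1\cdots v_m$ and $m/\ell$ pairwise disjoint copies of $G$, where for each $1\le i\le m/\ell$ the consecutive path vertices $v_{(i-1)\ell+1},\ldots,v_{i\ell}$ are identified, in order, with the vertices of a path $P_\ell$ (i.e. $\ell$ consecutive cycle vertices when $G$ is a cycle) in the $i$-th copy of $G$. *)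

(* Defs.v *)
From HB Require Import structures.
From mathcomp Require Import all_boot.

Set Implicit Arguments.
Unset Strict Implicit.
Unset Printing Implicit Defensive.

Record sgraph := SGraph {
  vertex :> finType;
  adj : rel vertex;
  adj_sym : symmetric adj;
  adj_irr : irreflexive adj
}.

Section Distance.
Variable G : sgraph.

Definition walk_of_length (u v : G) (n : nat) : bool :=
  [exists w : n.-tuple G, path (@adj G) u w && (last u w == v)].

Lemma connect_walk (u v : G) :
  connect (@adj G) u v -> exists n, walk_of_length u v n.
Proof.
move=> /connectP[w uw ->]; exists (size w).
by apply/existsP; exists (in_tuple w); rewrite uw eqxx.
Qed.

Definition gdist (u v : G) : option nat :=
  match @idP (connect (@adj G) u v) with
  | ReflectT uv => Some (ex_minn (connect_walk uv))
  | ReflectF _ => None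
  end.

(* [None] stands for the infinite distance between distinct components. *)
Definition gdist_ge (u v : G) (n : nat) : bool :=
  if gdist u v is Some d then n <= d else true.

End Distance.

(* A colour is an element of {0,...,k}; colour 0 is excluded explicitly, so
   that the numerical value of a colour is the one used in the distance
   condition. *)
Definition packing_coloring (H : sgraph) (k : nat) (c : H -> 'I_k.+1) : bool :=
  [forall v, 0 < c v] &&
  [forall u, forall v, (u != v) && (c u == c v) ==> gdist_ge u v (c u).+1].

Definition packing_colorable (H : sgraph) (k : nat) : bool :=
  [exists c : {ffun H -> 'I_k.+1}, packing_coloring c].

Lemma packing_colorable_exists (H : sgraph) : exists k, packing_colorable H k.
Proof.
exists #|H|; apply/existsP; exists [ffun v => lift ord0 (enum_rank v)].
apply/andP; split; first by apply/forallP => v; rewrite ffunE.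
apply/forallP => u; apply/forallP => v; rewrite !ffunE.
apply/implyP => /andP[uv /eqP/lift_inj/enum_rank_inj e].
by rewrite e eqxx in uv.
Qed.

Definition packing_chromatic_number (H : sgraph) : nat :=
  ex_minn (packing_colorable_exists H).

Section PathGraph.
Variable m : nat.

Definition path_adj : rel 'I_m :=
  fun i j => (i.+1 == j :> nat) || (j.+1 == i :> nat).

Lemma path_adj_sym : symmetric path_adj.
Proof. by move=> i j; rewrite /path_adj orbC. Qed.

Lemma path_adj_irr : irreflexive path_adj.
Proof. by move=> i; rewrite /path_adj orbb eqn_leq ltnn. Qed.

Definition path_graph : sgraph := SGraph path_adj_sym path_adj_irr.

End PathGraph.

Section CycleGraph.
Variable n : nat.

(* [i != j] only matters for n <= 1; this is the cycle C_n for n >= 3. *)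
Definition cycle_adj : rel 'I_n :=
  fun i j => (i != j) && ((j == ordS i) || (i == ordS j)).

Lemma cycle_adj_sym : symmetric cycle_adj.
Proof. by move=> i j; rewrite /cycle_adj eq_sym orbC. Qed.

Lemma cycle_adj_irr : irreflexive cycle_adj.
Proof. by move=> i; rewrite /cycle_adj eqxx. Qed.

Definition cycle_graph : sgraph := SGraph cycle_adj_sym cycle_adj_irr.

End CycleGraph.

(* A copy of the path P_l as a (not necessarily induced) subgraph of G,
   with its vertices listed in order. *)
Record path_in (l : nat) (G : sgraph) := PathIn {
  path_in_fun :> path_graph l -> G;
  path_in_inj : injective path_in_fun;
  path_in_adj : {homo path_in_fun : i j / adj i j}
}.

(* The copy of P_l formed by the consecutive vertices 0, ..., l - 1 of C_n. *)
Section CyclePath.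
Variables (l n : nat) (le_ln : l <= n).

Lemma widen_ord_path_inj : injective (widen_ord le_ln).
Proof. by move=> i j /(congr1 val) /= /val_inj. Qed.

Lemma widen_ord_path_adj :
  {homo (widen_ord le_ln : path_graph l -> cycle_graph n) : i j / adj i j}.
Proof.
move=> i j ij; apply/andP; split.
  by apply: contraTneq ij => /widen_ord_path_inj ->; rewrite adj_irr.
case/orP: ij => /eqP e; apply/orP; [left | right]; apply/eqP/val_inj => /=;
  by rewrite modn_small e // (leq_trans (ltn_ord _) le_ln).
Qed.

Definition cycle_path_in : path_in l (cycle_graph n) :=
  @PathIn l (cycle_graph n) (widen_ord le_ln) widen_ord_path_inj
    widen_ord_path_adj.

End CyclePath.

Section PathAligned.
Variables (m l : nat) (l_gt0 : 0 < l) (l_dvd_m : l %| m) (G : sgraph).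
(* [p i] is the path chosen in the i-th copy of G. *)
Variable p : 'I_(m %/ l) -> path_in l G.

(* Since l divides m, every vertex of P_m is identified with a vertex of some
   copy of G, so the vertex set of the product is that of the m / l disjoint
   copies of G: (i, x) is the vertex x of the i-th copy. *)
Definition pa_vertex : finType := ('I_(m %/ l) * G)%type.

Lemma glue_copy_subproof (j : 'I_m) : j %/ l < m %/ l.
Proof. by rewrite ltn_divLR // divnK. Qed.

Lemma glue_pos_subproof (j : 'I_m) : j %% l < l.
Proof. by rewrite ltn_pmod. Qed.

(* The vertex of the copies with which the path vertex j (numbered from 0) is
   identified. *)
Definition glue (j : path_graph m) : pa_vertex :=
  let i := Ordinal (glue_copy_subproof j) in
  (i, p i (Ordinal (glue_pos_subproof j))).

Definition pa_adj : rel pa_vertex :=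
  fun x y => (x.1 == y.1) && adj x.2 y.2
    || [exists j, exists j', [&& adj j j', glue j == x & glue j' == y]].

Lemma glue_inj : injective glue.
Proof.
move=> j j' e.
have /(congr1 val) /= ed : (glue j).1 = (glue j').1 by rewrite e.
have ei : Ordinal (glue_copy_subproof j) = Ordinal (glue_copy_subproof j').
  exact: val_inj.
move: e; rewrite /glue /= ei => -[/path_in_inj /(congr1 val) /= em].
by apply: ord_inj; rewrite (divn_eq j l) ed em -divn_eq.
Qed.

Lemma pa_adj_sym : symmetric pa_adj.
Proof.
move=> x y; rewrite /pa_adj eq_sym adj_sym; congr (_ || _).
by apply/existsP/existsP => -[j /existsP[j' /and3P[a b c]]];
  exists j'; apply/existsP; exists j; rewrite adj_sym a b c.
Qed.

Lemma pa_adj_irr : irreflexive pa_adj.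
Proof.
move=> x; rewrite /pa_adj adj_irr andbF /=; apply/existsP.
move=> -[j /existsP[j' /and3P[a /eqP b /eqP c]]].
by move: a; rewrite (glue_inj (etrans b (esym c))) path_adj_irr.
Qed.

(* The product P_m <>_l G.  Connectedness and vertex-transitivity of G are not
   needed to form it. *)
Definition path_aligned : sgraph := SGraph pa_adj_sym pa_adj_irr.

End PathAligned.

(* Main.v *)
Require Import Defs.
From HB Require Import structures.
From mathcomp Require Import all_boot.
From mathcomp Require Import zify.

Set Implicit Arguments.
Unset Strict Implicit.
Unset Printing Implicit Defensive.

(** The product is a string of triangles [a_i b_i c_i] in which [c_i] is joined
    to [a_(i+1)].  Upper bounds: colour every [a_i] with 1, every [b_i] with 2
    and the [c_i] with 3, 4, 5, 3, 4, 5, ... (only 3, 4, 3 when [t <= 3]); two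
    vertices [c_i], [c_j] are at distance [2 |i - j|].  Lower bounds: the three
    vertices of a triangle have distinct colours, so each triangle has a vertex
    of colour at least 3; vertices of adjacent triangles are at distance at most
    3, so colour 3 cannot serve two adjacent triangles. *)

Local Arguments adj : simpl never.

Section Packing.
Variable G : sgraph.

Lemma gdist_ge_path (u : G) (w : seq G) (n : nat) :
  gdist_ge u (last u w) n -> path (@adj G) u w -> n <= size w.
Proof.
rewrite /gdist_ge /gdist => + uw.
case: {-}_ / idP => [uv|nuv]; last by case: nuv; apply/connectP; exists w.
case: ex_minnP => d _ dmin nd; apply: leq_trans nd (dmin _ _).
by apply/existsP; exists (in_tuple w); rewrite uw eqxx.
Qed.

Lemma gdist_ge_lipschitz (f : G -> nat) (u v : G) :
  f u = 0 -> (forall x y, adj x y -> f y <= (f x).+1) -> gdist_ge u v (f v).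
Proof.
move=> fu0 lipf; rewrite /gdist_ge /gdist; case: {-}_ / idP => // uv.
case: ex_minnP => d /existsP[w /andP[uw /eqP<-]] _.
suff: f (last u w) <= f u + size w by rewrite fu0 size_tuple.
elim: (tval w) u {fu0 uv} uw => [|x s IHs] u /=; first by rewrite addn0.
move=> /andP[/lipf ux /IHs xs]; apply: leq_trans xs _.
by rewrite addnS -addSn leq_add2r.
Qed.

Lemma gdist_ge_leq (u v : G) (m n : nat) :
  m <= n -> gdist_ge u v n -> gdist_ge u v m.
Proof. by move=> mn; rewrite /gdist_ge; case: gdist => // d /(leq_trans mn). Qed.

Lemma packing_colorable_fun (k : nat) (c : G -> nat) :
  (forall v, 0 < c v <= k) ->
  (forall u v, u != v -> c u = c v -> gdist_ge u v (c u).+1) ->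
  packing_colorable G k.
Proof.
move=> ck cP; apply/existsP; exists [ffun v => inord (c v)].
have cE v : (inord (c v) : 'I_k.+1) = c v :> nat.
  by rewrite inordK // ltnS; case/andP: (ck v).
apply/andP; split; first by apply/forallP=> v; rewrite ffunE cE; case/andP: (ck v).
apply/forallP=> u; apply/forallP=> v; rewrite !ffunE; apply/implyP.
by move=> /andP[uv /eqP/(congr1 val) /=]; rewrite !cE; apply: cP.
Qed.

Lemma packing_chromatic_number_le (k : nat) :
  packing_colorable G k -> packing_chromatic_number G <= k.
Proof. by rewrite /packing_chromatic_number; case: ex_minnP => m _; apply. Qed.

Lemma packing_chromatic_number_ge (n : nat) :
  (forall k, packing_colorable G k -> n <= k) -> n <= packing_chromatic_number G.
Proof. by rewrite /packing_chromatic_number; case: ex_minnP => m + _ le_n => /le_n. Qed.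

Section Coloring.
Variables (k : nat) (c : G -> 'I_k.+1).
Hypothesis cP : packing_coloring c.

Lemma packing_coloring_gt0 (v : G) : 0 < c v.
Proof. by case/andP: cP => /forallP. Qed.

Lemma packing_coloring_dist (u v : G) :
  u != v -> c u = c v :> nat -> gdist_ge u v (c u).+1.
Proof.
case/andP: cP => _ /forallP/(_ u)/forallP/(_ v)/implyP cuv uv /val_inj e.
by apply: cuv; rewrite uv e eqxx.
Qed.

Lemma packing_coloring_adj (u v : G) : adj u v -> c u <> c v :> nat.
Proof.
move=> uv e; have neq_uv : u != v by apply: contraTneq uv => ->; rewrite adj_irr.
have := @gdist_ge_path u [:: v] _ (packing_coloring_dist neq_uv e).
by rewrite /= uv => /(_ isT); rewrite ltnS leqNgt packing_coloring_gt0.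
Qed.

Lemma packing_coloring_triangle (x y z : G) :
  adj x y -> adj y z -> adj x z -> exists2 v, v \in [:: x; y; z] & 3 <= c v.
Proof.
move=> /packing_coloring_adj xy /packing_coloring_adj yz /packing_coloring_adj xz.
have := (packing_coloring_gt0 x, packing_coloring_gt0 y, packing_coloring_gt0 z).
case=> -[x0 y0] z0.
have [?|?] := leqP 3 (c x); first by exists x; rewrite ?inE ?eqxx ?orbT.
have [?|?] := leqP 3 (c y); first by exists y; rewrite ?inE ?eqxx ?orbT.
by exists z; rewrite ?inE ?eqxx ?orbT //; lia.
Qed.

End Coloring.
End Packing.

Section TriangleString.
Variables (t : nat) (p : 'I_(3 * t %/ 3) -> path_in 3 (cycle_graph 3)).
Let H := path_aligned (isT : 0 < 3) (dvdn_mulr t (dvdnn 3)) p.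

(* [k = 0, 1, 2] gives [a_i], [b_i], [c_i]. *)
Definition tri (i : 'I_(3 * t %/ 3)) (k : 'I_3) : H := (i, p i k).

Definition tri_index (x : H) : 'I_3 := invF (@path_in_inj _ _ (p x.1)) x.2.

Lemma tri_indexK (x : H) : tri x.1 (tri_index x) = x.
Proof. by case: x => i x; rewrite /tri /tri_index /= (f_invF (@path_in_inj _ _ (p i))). Qed.

Lemma triK i k : tri_index (tri i k) = k.
Proof. exact: (invF_f (@path_in_inj _ _ (p i))). Qed.

Lemma adj_C3 (x y : cycle_graph 3) : adj x y = (x != y).
Proof. by case: x y => [[|[|[|//]]] ?] [[|[|[|//]]] ?]. Qed.

Definition tri_adj (i k j l : nat) : bool :=
  [|| (i == j) && (k != l), [&& j == i.+1, k == 2 & l == 0]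
    | [&& i == j.+1, l == 2 & k == 0]].

Lemma adj_tri i k j l : adj (tri i k) (tri j l) = tri_adj i k j l.
Proof.
have glueE n : glue (isT : 0 < 3) (dvdn_mulr t (dvdnn 3)) p n =
    tri (Ordinal (glue_copy_subproof (isT : 0 < 3) (dvdn_mulr t (dvdnn 3)) n))
        (Ordinal (glue_pos_subproof (isT : 0 < 3) n)) by [].
have tri_inj i1 k1 i2 k2 : tri i1 k1 = tri i2 k2 -> i1 = i2 /\ k1 = k2.
  by move=> e; move: (congr1 tri_index e) (congr1 fst e); rewrite !triK.
have ltp (i1 : 'I_(3 * t %/ 3)) (k1 : 'I_3) : 3 * i1 + k1 < 3 * t.
  by have := ltn_ord i1; have := ltn_ord k1; lia.
have glue_tri i1 k1 : glue (isT : 0 < 3) (dvdn_mulr t (dvdnn 3)) p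
    (Ordinal (ltp i1 k1)) = tri i1 k1.
  rewrite glueE; congr (tri _ _); apply: val_inj => /=;
    by have := ltn_ord k1; lia.
have lk := ltn_ord k; have ll := ltn_ord l.
rewrite -[LHS]/(pa_adj (isT : 0 < 3) (dvdn_mulr t (dvdnn 3)) p (tri i k) (tri j l)).
rewrite /pa_adj /tri_adj [(tri i k).1]/= [(tri i k).2]/= [(tri j l).1]/= [(tri j l).2]/=.
apply/orP/idP.
- case=> [/andP[/eqP ij]|].
    rewrite -{}ij adj_C3 (inj_eq (@path_in_inj _ _ (p i))) eqxx => kl.
    by rewrite -(inj_eq val_inj) in kl; rewrite kl.
  move=> /existsP[n /existsP[n' /and3P[nn' /eqP e /eqP e']]].
  move: e e'; rewrite !glueE => /tri_inj[/(congr1 val)/= <- /(congr1 val)/= <-].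
  move=> /tri_inj[/(congr1 val)/= <- /(congr1 val)/= <-].
  by move: nn'; rewrite /adj /= /path_adj; lia.
- case/or3P=> [/andP[/eqP/val_inj ij kl]|/and3P[/eqP ij /eqP k2 /eqP l0]
              |/and3P[/eqP ij /eqP k2 /eqP l0]].
  + left; rewrite -ij eqxx adj_C3 (inj_eq (@path_in_inj _ _ (p i))).
    by rewrite -(inj_eq val_inj).
  + right; apply/existsP; exists (Ordinal (ltp i k)).
    apply/existsP; exists (Ordinal (ltp j l)).
    by rewrite !glue_tri !eqxx /adj /= /path_adj /=; lia.
  + right; apply/existsP; exists (Ordinal (ltp i k)).
    apply/existsP; exists (Ordinal (ltp j l)).
    by rewrite !glue_tri !eqxx /adj /= /path_adj /=; lia.
Qed.

Definition tri_dist (i k j l : nat) : nat :=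
  if i == j then (k != l : nat)
  else if i < j then (2 * (j - i)).-1 + (k != 2) + (l != 0)
  else (2 * (i - j)).-1 + (l != 2) + (k != 0).

Lemma tri_dist_lipschitz (i k j l j' l' : nat) :
  k < 3 -> l < 3 -> l' < 3 -> tri_adj j l j' l' ->
  tri_dist i k j' l' <= (tri_dist i k j l).+1.
Proof.
by rewrite /tri_adj /tri_dist; case: (ltngtP i j); case: (ltngtP i j'); lia.
Qed.

Lemma gdist_ge_tri i k j l : gdist_ge (tri i k) (tri j l) (tri_dist i k j l).
Proof.
rewrite -[in tri_dist _ _ _ _](triK j l).
apply: (gdist_ge_lipschitz (f := fun x : H => tri_dist i k x.1 (tri_index x))).
  by rewrite triK /tri_dist !eqxx.
move=> x y; rewrite -{1}(tri_indexK x) -{1}(tri_indexK y) adj_tri.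
exact: tri_dist_lipschitz.
Qed.

Lemma packing_colorable_tri (K : nat) (e : nat -> nat) :
  (forall i, i < t -> 3 <= e i <= K) ->
  (forall i j, i < j -> j < t -> e i = e j -> e i < 2 * (j - i)) ->
  3 <= K -> packing_colorable H K.
Proof.
move=> eK eP K3.
pose c (x : H) := if tri_index x == 2 :> nat then e x.1 else (tri_index x).+1.
have lt_t (i : 'I_(3 * t %/ 3)) : i < t by have := ltn_ord i; lia.
have lt3 (x : H) := ltn_ord (tri_index x).
apply: (packing_colorable_fun (c := c)) => [x|x y xy cxy].
  by have := eK _ (lt_t x.1); have := lt3 x; rewrite /c; case: eqP; lia.
have := gdist_ge_tri x.1 (tri_index x) y.1 (tri_index y).
rewrite !tri_indexK; apply: gdist_ge_leq.
have {}xy : x.1 != y.1 :> nat \/ tri_index x != tri_index y :> nat.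
  case: (eqVneq (x.1 : nat) y.1) => [/val_inj e1|]; [right|by left].
  apply: contraNneq xy => /val_inj e2.
  by rewrite -(tri_indexK x) e1 e2 tri_indexK.
move: cxy xy; rewrite /c /tri_dist.
have := (eP x.1 y.1, eP y.1 x.1).
have := (eK _ (lt_t x.1), eK _ (lt_t y.1)).
have := (lt_t x.1, lt_t y.1); have := (lt3 x, lt3 y).
move: (nat_of_ord x.1) (nat_of_ord y.1) => i j.
move: (nat_of_ord (tri_index x)) (nat_of_ord (tri_index y)) => k l.
case=> kl3 ll3 [it jt] [ei ej] [eij eji].
have [ij|ji|ij] := ltngtP i j.
- by have := eij ij jt; case: eqP; case: eqP; lia.
- by have := eji ji it; case: eqP; case: eqP; lia.
- by rewrite -ij; case: eqP; case: eqP; lia.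
Qed.

Lemma packing_coloring_tri (K : nat) (c : H -> 'I_K.+1) (i : 'I_(3 * t %/ 3)) :
  packing_coloring c -> exists k, 3 <= c (tri i k).
Proof.
move=> cP; pose o k : 'I_3 := inord k.
have [||| v + cv] := @packing_coloring_triangle _ _ _ cP
    (tri i (o 0)) (tri i (o 1)) (tri i (o 2)).
- by rewrite adj_tri /tri_adj !inordK ?eqxx.
- by rewrite adj_tri /tri_adj !inordK ?eqxx.
- by rewrite adj_tri /tri_adj !inordK ?eqxx.
by rewrite !inE => /or3P[] /eqP ev; rewrite ev in cv; eexists; exact: cv.
Qed.

Lemma packing_chromatic_number_tri_ge3 :
  0 < t -> 3 <= packing_chromatic_number H.
Proof.
move=> t0; apply: packing_chromatic_number_ge => K /existsP[c cP].
have i0 : 0 < 3 * t %/ 3 by lia.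
have [k] := packing_coloring_tri (Ordinal i0) cP.
by move/leq_trans; apply; rewrite -ltnS.
Qed.

Lemma packing_chromatic_number_tri_ge4 :
  1 < t -> 4 <= packing_chromatic_number H.
Proof.
move=> t1; apply: packing_chromatic_number_ge => K /existsP[c cP].
rewrite leqNgt; apply/negP => K3.
have i0 : 0 < 3 * t %/ 3 by lia.
have i1 : 1 < 3 * t %/ 3 by lia.
pose I0 := Ordinal i0; pose I1 := Ordinal i1; pose o k : 'I_3 := inord k.
have [k ck] := packing_coloring_tri I0 cP.
have [l cl] := packing_coloring_tri I1 cP.
have c_le3 v : c v <= 3 by rewrite -ltnS (leq_trans (ltn_ord _)).
have ck3 : c (tri I0 k) = 3 :> nat by apply/eqP; rewrite eqn_leq c_le3.
have cl3 : c (tri I1 l) = 3 :> nat by apply/eqP; rewrite eqn_leq c_le3.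
have neq : tri I0 k != tri I1 l by apply/eqP => /(congr1 fst).
have := packing_coloring_dist cP neq; rewrite ck3 cl3 => /(_ erefl) dkl.
pose w := (if k == o 2 then [::] else [:: tri I0 (o 2)])
  ++ tri I1 (o 0) :: (if l == o 0 then [::] else [:: tri I1 l]).
have sw : size w <= 3 by rewrite /w size_cat /=; case: ifP; case: ifP.
have wl : last (tri I0 k) w = tri I1 l.
  by rewrite /w last_cat /=; case: (eqVneq l (o 0)) => [->|].
have wp : path (@adj H) (tri I0 k) w.
  have bridge : adj (tri I0 (o 2)) (tri I1 (o 0)).
    by rewrite adj_tri /tri_adj !inordK.
  have tail : path (@adj H) (tri I1 (o 0))
      (if l == o 0 then [::] else [:: tri I1 l]).
    case: (eqVneq l (o 0)) => //= lo; rewrite adj_tri /tri_adj eqxx /= andbT.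
    by rewrite -(inj_eq val_inj) /= eq_sym in lo; rewrite lo.
  rewrite /w; case: (eqVneq k (o 2)) => [->|ko] /=; rewrite bridge tail //.
  rewrite adj_tri /tri_adj eqxx /= !andbT.
  by rewrite -(inj_eq val_inj) /= in ko; rewrite ko.
by rewrite -wl in dkl; have := gdist_ge_path dkl wp; lia.
Qed.

End TriangleString.

Theorem theorem12 (t : nat) (ht : 1 <= t)
    (p : 'I_(3 * t %/ 3) -> path_in 3 (cycle_graph 3)) :
  let chi_p := packing_chromatic_number
    (path_aligned (isT : 0 < 3) (dvdn_mulr t (dvdnn 3)) p) in
  [/\ t = 1 -> chi_p <= 3,
      2 <= t <= 3 -> chi_p <= 4,
      4 <= t -> chi_p <= 5,
      t = 1 -> chi_p = 3
    & 2 <= t <= 3 -> chi_p = 4].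
Proof.
move=> chi_p.
have le3 : t = 1 -> chi_p <= 3.
  move=> t1; apply: packing_chromatic_number_le.
  by apply: (@packing_colorable_tri t p 3 (fun=> 3)) => //; lia.
have le4 : 2 <= t <= 3 -> chi_p <= 4.
  move=> t23; apply: packing_chromatic_number_le.
  by apply: (@packing_colorable_tri t p 4 (fun i => 3 + i %% 2)) => //; lia.
have le5 : 4 <= t -> chi_p <= 5.
  move=> t4; apply: packing_chromatic_number_le.
  by apply: (@packing_colorable_tri t p 5 (fun i => 3 + i %% 3)) => //; lia.
split=> //.
- by move=> t1; apply/eqP; rewrite eqn_leq le3 // packing_chromatic_number_tri_ge3.
- move=> t23; apply/eqP; rewrite eqn_leq le4 //.
  by rewrite packing_chromatic_number_tri_ge4 //; case/andP: t23.
Qed.
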